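(* For every integer $k\geq 0$, $\left|\mathsf{APS}^+_{2k+1} \setminus \mathsf{APS}_{2k+1}\right|=4^k - \binom{2k}{k}$.
   Context: For $n\in\mathbb{N}$, $[n]=\{1,\dots,n\}$ and $\pm[n]=[n]\cup -[n]$. $\mathfrak{S}_n$ is the symmetric group of bijections of $[n]$, and $\mathfrak{S}_n^B$ is the group of signed permutations, i.e. bijections $w:\pm[n]\to\pm[n]$ with $w(-i)=-w(i)$, written in one-line notation $w(1)\cdots w(n)$ (so $\mathfrak{S}_n\subseteq\mathfrak{S}_n^B$). A pinnacle of $w$ is a value $w(i)$ with $2\le i\le n-1$ and $w(i-1)<w(i)>w(i+1)$; the pinnacle set of $w$ is the set of its pinnacles. $\mathsf{APS}_n$ is the set of pinnacle sets of elements of $\mathfrak{S}_n$, $\mathsf{APS}^B_n$ is the set of pinnacle sets of elements of $\mathfrak{S}_n^B$, and $\mathsf{APS}^+_n=\{S\in\mathsf{APS}^B_n : S\subset\mathbb{N}\}$, where $\mathbb{N}=\{1,2,3,\dots\}$. *)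

(* Defs.v *)
From mathcomp Require Import all_boot all_order all_fingroup all_algebra.
From mathcomp Require Import finmap.

Set Implicit Arguments.
Unset Strict Implicit.
Unset Printing Implicit Defensive.

Import Order.TTheory GRing.Theory Num.Theory.
Local Open Scope fset_scope.
Local Open Scope ring_scope.

(* [n] = {1, ..., n} inside the integers. *)
Definition int_range (n : nat) : {fset int} := [fset Posz i | i in iota 1 n].

Definition pm_range (n : nat) : {fset int} :=
  int_range n `|` [fset - x | x in int_range n].

(* The bijections of a finite set A of integers are the elements of {perm A};
   app w i is w(i) for i in A, and is 0 when i is not in A. *)
Definition app (A : {fset int}) (w : {perm A}) (i : int) : int :=
  if insub i is Some x then val (w x) else 0.

(* Used with A = [n] or A = \pm[n]; the bounds on i ensure that i - 1, i and
   i + 1 all lie in [n], so the default value of app plays no role. *)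
Definition is_pinnacle_at (n : nat) (A : {fset int}) (w : {perm A}) (i : int) :
    bool :=
  [&& 2 <= i, i <= n%:Z - 1, app w (i - 1) < app w i & app w (i + 1) < app w i].

Definition pinnacle_set (n : nat) (A : {fset int}) (w : {perm A}) :
    {fset int} :=
  [fset app w i | i in A & is_pinnacle_at n w i].

Definition is_signed_perm (n : nat) (w : {perm (pm_range n)}) : bool :=
  [forall i : pm_range n, app w (- val i) == - app w (val i)].

Definition APS (n : nat) : {fset {fset int}} :=
  [fset pinnacle_set n w | w in {perm (int_range n)}].

Definition APSB (n : nat) : {fset {fset int}} :=
  [fset pinnacle_set n w | w in {perm (pm_range n)} & is_signed_perm w].

Definition APSplus (n : nat) : {fset {fset int}} :=
  [fset S in APSB n | [forall x : S, 0 < val x]].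

(* Main.v *)
Require Import Defs.
From mathcomp Require Import all_boot all_order all_fingroup all_algebra.
From mathcomp Require Import finmap zify.

(** A set S of positive integers in [n] is the pinnacle set of a signed
    permutation as soon as 2|S| < n: make every other value negative and
    interleave, so that each element of S has two negative neighbours. For
    n = 2k+1 these are the sets with at most k elements, and there are 4^k of
    them by complementation. For an unsigned permutation, the elements of S up
    to m need one more smaller non-pinnacle than there are of them, so that
    2|S & [m]| < m for all m >= 1; conversely, under this condition interleaving
    the increasing lists of S and of its complement works. The sets meeting
    this ballot condition are counted by 'C(2k, k), via the reflection
    principle. *)

Set Implicit Arguments.
Unset Strict Implicit.
Unset Printing Implicit Defensive.

Import Order.TTheory GRing.Theory Num.Theory.
Local Open Scope nat_scope.

(** * Counting ballot sequences *)

Fixpoint bitseqs (n : nat) : seq (seq bool) :=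
  if n is m.+1 then
    map (cons true) (bitseqs m) ++ map (cons false) (bitseqs m)
  else [:: [::]].

Lemma mem_bitseqs (n : nat) (b : seq bool) : (b \in bitseqs n) = (size b == n).
Proof.
elim: n b => [|n IHn] [|x b] //=.
  rewrite mem_cat; apply/negbTE; rewrite negb_or.
  by apply/andP; split; apply/mapP => -[].
rewrite mem_cat eqSS -IHn.
have inj y : injective (cons y : seq bool -> seq bool) by move=> ? ? [].
have diff y z l : (z :: b \in map (cons y) l) = (z == y) && (b \in l).
  case: (eqVneq z y) => [->|zy]; first by rewrite mem_map.
  by apply/negbTE/mapP => -[? _ []] /eqP; rewrite (negbTE zy).
by rewrite !diff; case: x; rewrite ?orbF.
Qed.

Lemma bitseqs_uniq (n : nat) : uniq (bitseqs n).
Proof.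
elim: n => //= n IHn; rewrite cat_uniq !map_inj_uniq ?IHn ?andbT //=;
  try by move=> ? ? [].
by apply/hasPn => _ /mapP[b _ ->]; apply/mapP => -[].
Qed.

Lemma size_bitseqs (n : nat) : size (bitseqs n) = 2 ^ n.
Proof. by elim: n => //= n IHn; rewrite size_cat !size_map IHn expnS; lia. Qed.

(** Complementation swaps the halves starting with [true] and with [false], hence permutes the
    enumeration. *)
Lemma count_bitseqs_negb (n : nat) (P : pred (seq bool)) :
  count (fun b => P (map negb b)) (bitseqs n) = count P (bitseqs n).
Proof.
elim: n P => //= n IHn P; rewrite !count_cat !count_map addnC.
by congr (_ + _); rewrite -[RHS]IHn; apply: eq_count => b.
Qed.

(** The length is odd, so complementation exchanges the sequences with at most [k] ones and those
    with more; each kind is half of all [2 ^ (2 * k + 1)]. *)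
Lemma count_light_bitseqs (k : nat) :
  count (fun b => count id b <= k) (bitseqs (2 * k + 1)) = 4 ^ k.
Proof.
set P := fun b => _; set n := (2 * k + 1).
have : count P (bitseqs n) + count (predC P) (bitseqs n) = 2 ^ n.
  by rewrite count_predC size_bitseqs.
have -> : count (predC P) (bitseqs n) = count P (bitseqs n).
  rewrite -[RHS]count_bitseqs_negb; apply: eq_in_count => b /=.
  rewrite mem_bitseqs /P count_map => /eqP sb.
  have := count_predC id b; rewrite sb /n.
  have -> : count (preim negb id) b = count (predC id) b by apply: eq_count.
  by lia.
by rewrite /n addn1 expnS expnM -[2 ^ 2]/4; lia.
Qed.

(** A lattice path from height [h] that must stay nonnegative: [false] is an up-step and [true] a
    down-step. *)
Fixpoint ballot (h : nat) (b : seq bool) : bool :=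
  match b with
  | [::] => true
  | false :: b' => ballot h.+1 b'
  | true :: b' => if h is h'.+1 then ballot h' b' else false
  end.

Lemma ballotP (h : nat) (b : seq bool) :
  reflect (forall m, 2 * count id (take m b) <= m + h) (ballot h b).
Proof.
elim: b h => [|[] b IHb] h /=; first by constructor.
- case: h => [|h].
    by constructor=> /(_ 1); rewrite /= take0.
  apply: (iffP (IHb _)) => [H [|m] //=|H m]; first by have := H m; lia.
  by have := H m.+1; rewrite /=; lia.
- apply: (iffP (IHb _)) => [H [|m] //=|H m]; first by have := H m; lia.
  by have := H m.+1; rewrite /=; lia.
Qed.

(* By the reflection principle, the paths of length m from height h that stay
   nonnegative are equinumerous with those whose displacement lies in the
   window (-(h+1), h+1]; u is the number of up-steps. *)
Lemma count_ballot (m h N : nat) : m < N ->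
  count (ballot h) (bitseqs m)
    = \sum_(u < N) ((m <= 2 * u + h) && (2 * u <= m + h + 1)) * 'C(m, u).
Proof.
elim: m h N => [|m IHm] h [|N] // mN.
  rewrite big_ord_recl bin0 /= big1 ?addn0; first by lia.
  by move=> i _; rewrite bin0n muln0.
rewrite /= count_cat !count_map.
have -> : count (preim (cons false) (ballot h)) (bitseqs m)
    = count (ballot h.+1) (bitseqs m) by apply: eq_count.
rewrite (IHm _ N) //.
have -> : count (preim (cons true) (ballot h)) (bitseqs m)
    = \sum_(u < N) ((m < 2 * u + h) && (2 * u <= m + h)) * 'C(m, u).
  (* From height 0 no down-step is allowed, and the window [m < 2 * u <= m] is empty accordingly. *)
  case: h => [|h].
    rewrite (eq_count (_ : _ =1 pred0)) // count_pred0 big1 // => u _.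
    by case: (boolP (_ && _)) => //; lia.
  rewrite (eq_count (_ : _ =1 ballot h)) // (IHm _ N) //.
  by apply: eq_bigr => u _; congr (nat_of_bool _ * _); lia.
rewrite big_ord_recl bin0 /=.
under [in RHS]eq_bigr => i _ do rewrite binS mulnDr.
rewrite big_split addnA /=.
(* Pascal's rule has split the right side. The part with ['C(m, i.+1)] absorbs the term [u = 0]; the
   extra top term ['C(m, N)] vanishes since [m < N]. *)
have shift (c : nat -> bool) :
    c 0 * 1 + \sum_(i < N) c (bump 0 i) * 'C(m, i.+1)
    = \sum_(i < N) c i * 'C(m, i).
  have := @big_ord_recl _ 0 addn N (fun i => c i * 'C(m, i)).
  by rewrite big_ord_recr /= bin0 bin_small // muln0 addn0.
rewrite (shift (fun u => (m < 2 * u + h) && (2 * u <= m.+1 + h + 1))).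
rewrite -!big_split /=; apply: eq_bigr => u _; rewrite -!mulnDl.
(* Both sides pair the same two lower and two upper bounds on [u], but differently. The indicators
   add up alike because a [u] failing a lower bound meets both upper ones. *)
by congr (_ * _); rewrite /bump; lia.
Qed.

(** From height 0 with [2 * k] steps, the window leaves only [u = k]. *)
Lemma count_ballot0 (k : nat) :
  count (ballot 0) (bitseqs (2 * k)) = 'C(2 * k, k).
Proof.
have kk : k < (2 * k).+1 by lia.
rewrite (count_ballot _ (ltnSn _)) (bigD1 (Ordinal kk)) //= big1 => [|u].
  by rewrite (_ : _ && _ = true) ?mul1n; lia.
by rewrite -val_eqE /= => uk; rewrite (_ : _ && _ = false) ?mul0n //; lia.
Qed.

(* Bit i of b records whether i + 1 is a pinnacle; value 1 never is. *)
Definition admissible (b : seq bool) : bool :=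
  if b is x :: b' then ~~ x && ballot 0 b' else true.

(** The initial [false] turns the ballot bound into a strict one for [m > 0]; writing it with [.-1]
    lets it hold at [m = 0] too. *)
Lemma admissibleP (b : seq bool) :
  reflect (forall m, 2 * count id (take m b) <= m.-1) (admissible b).
Proof.
case: b => [|[] b] /=; first by constructor.
  by constructor=> /(_ 1); rewrite /= take0.
apply: (iffP (ballotP _ _)) => [H [|m] //=|H m]; first by have := H m; lia.
by have := H m.+1; rewrite /=; lia.
Qed.

(** Admissible sequences are [false] followed by a ballot sequence of length [2 * k], and the bound
    at full length makes them all light. The additive form avoids truncated subtraction. *)
Lemma count_light_inadmissible (k : nat) :
  count (fun b => (count id b <= k) && ~~ admissible b) (bitseqs (2 * k + 1))
    + 'C(2 * k, k) = 4 ^ k.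
Proof.
rewrite -count_light_bitseqs -count_ballot0.
have -> : count (ballot 0) (bitseqs (2 * k))
    = count admissible (bitseqs (2 * k + 1)).
  rewrite addn1 /= count_cat !count_map.
  rewrite (eq_count (_ : preim (cons true) admissible =1 pred0)) //.
  by rewrite count_pred0; apply: eq_count.
have -> : count admissible (bitseqs (2 * k + 1)) =
   count (fun b => (count id b <= k) && admissible b) (bitseqs (2 * k + 1)).
  apply: eq_in_count => b; rewrite mem_bitseqs => /eqP sb.
  case: (boolP (admissible b)) => [/admissibleP/(_ (size b))|];
    rewrite ?andbF //.
  by rewrite take_size sb; lia.
elim: (bitseqs _) => //= b s; case: (_ <= k) (admissible b) => -[] /=; lia.
Qed.

(** * Pinnacles of words *)

Fixpoint pins (l : seq int) : seq int :=
  match l with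
  | a :: ((b :: c :: _) as l') =>
      if ((a < b) && (c < b))%R then b :: pins l' else pins l'
  | _ => [::]
  end.

Lemma pins_cons3 (a b c : int) (l : seq int) : pins [:: a, b, c & l] =
  if ((a < b) && (c < b))%R then b :: pins [:: b, c & l]
  else pins [:: b, c & l].
Proof. by []. Qed.

Lemma pins_descent (a b : int) (l : seq int) :
  (b < a)%R -> pins [:: a, b & l] = pins (b :: l).
Proof.
by move=> ba; case: l => [|c l] //; rewrite pins_cons3 ltNge ltW.
Qed.

Lemma pins_ascending (l : seq int) : sorted <%R l -> pins l = [::].
Proof.
elim: l => [|a [|b [|c l]] IHl] // /andP[ab H].
rewrite pins_cons3 IHl //.
by case/andP: H => bc _; rewrite [(c < b)%R]ltNge (ltW bc) andbF.
Qed.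

(** The right neighbour [c] of a peak [b] is not itself a peak, so after a peak the induction may
    drop two entries and resume at [c]. *)
Lemma pins_ind (P : seq int -> Prop) :
  P [::] -> (forall a, P [:: a]) -> (forall a b, P [:: a; b]) ->
  (forall a b c l, (a < b)%R -> (c < b)%R -> P (c :: l) ->
     P [:: a, b, c & l]) ->
  (forall a b c l, ~~ ((a < b) && (c < b))%R -> P [:: b, c & l] ->
     P [:: a, b, c & l]) ->
  forall l, P l.
Proof.
move=> P0 P1 P2 Pp Pn l.
have [n] := ubnP (size l); elim: n l => // n IHn [|a [|b [|c l]]] //= sl.
case: (boolP ((a < b) && (c < b))%R) => [/andP[ab cb]|nab].
  by apply: Pp => //; apply: IHn => /=; lia.
by apply: Pn => //; apply: IHn => /=; lia.
Qed.

Lemma pins_peak (a b c : int) (l : seq int) : (a < b)%R -> (c < b)%R ->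
  pins [:: a, b, c & l] = b :: pins (c :: l).
Proof. by move=> ab cb; rewrite pins_cons3 ab cb (pins_descent _ cb). Qed.

Lemma pins_nopeak (a b c : int) (l : seq int) : ~~ ((a < b) && (c < b))%R ->
  pins [:: a, b, c & l] = pins [:: b, c & l].
Proof. by rewrite pins_cons3 => /negbTE->. Qed.

Lemma subseq_pins (l : seq int) : subseq (pins l) l.
Proof.
elim/pins_ind: l => // a b c l.
  move=> ab cb IHl; rewrite pins_peak //.
  by apply: subseq_trans (subseq_cons _ a); rewrite [X in is_true X]/= eqxx.
move=> ab IHl; rewrite pins_nopeak //.
by apply: subseq_trans IHl (subseq_cons _ a).
Qed.

(* Each pinnacle below m is charged to itself and its left neighbour; the right
   neighbour of the last one is the spare entry. *)
Lemma count_pins (m : int) (l : seq int) :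
  2 * count (fun x => x <= m)%R (pins l) <= (count (fun x => x <= m)%R l).-1.
Proof.
elim/pins_ind: l => // a b c l.
  by move=> ab cb; rewrite pins_peak //=; lia.
by move=> ab; rewrite pins_nopeak //=; lia.
Qed.

Lemma mem_pinsP (l : seq int) (x : int) :
  reflect (exists2 i, i.+2 < size l &
     [/\ x = nth 0%R l i.+1, (nth 0 l i < nth 0 l i.+1)%R
       & (nth 0 l i.+2 < nth 0 l i.+1)%R]) (x \in pins l).
Proof.
elim: l => [|a [|b [|c l]] IHl]; try by constructor=> -[].
rewrite pins_cons3; apply: (iffP idP) => [|[[|i]] il [Ex h1 h2]].
- case: ifP => [/andP[ab cb]|_].
    rewrite inE => /predU1P[->|/IHl[i il H]]; first by exists 0.
    by exists i.+1.
  by case/IHl => i il H; exists i.+1.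
- by move: h1 h2; rewrite Ex /= => -> ->; rewrite mem_head.
- have H : x \in pins [:: b, c & l].
    by apply/IHl; exists i.
  by case: ifP => // _; rewrite inE H orbT.
Qed.

Fixpoint weave (P Q : seq int) : seq int :=
  match P, Q with
  | p :: P', q :: Q' => [:: q, p & weave P' Q']
  | _, _ => Q
  end.

Lemma perm_weave (P Q : seq int) :
  size P <= size Q -> perm_eq (weave P Q) (P ++ Q).
Proof.
elim: P Q => [|p P IHP] [|q Q] //= PQ.
apply/seq.permP=> a; have /seq.permP/(_ a) := IHP Q PQ.
by rewrite /= !count_cat /=; lia.
Qed.

(** Each entry of [P] stands between two consecutive entries of [Q]. As [Q] increases, it suffices
    to exceed the right one, of index [i.+1]. The leftover tail of [Q] ascends and adds no peak. *)
Lemma pins_weave (P Q : seq int) :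
  sorted <%R Q -> size P < size Q ->
  (forall i, i < size P -> (nth 0 Q i.+1 < nth 0 P i)%R) ->
  pins (weave P Q) = P.
Proof.
elim: P Q => [|p P IHP] [|q Q] // sQ PQ H; first exact: pins_ascending.
case: Q sQ PQ H => [|q' Q] // /andP[qq' sQ] PQ H.
have q'p : (q' < p)%R := H 0 isT.
have [l El] : exists l, weave P (q' :: Q) = q' :: l.
  by case: P {IHP PQ H} => [|? ?]; eexists.
rewrite -[weave _ _]/[:: q, p & weave P (q' :: Q)] El.
rewrite pins_peak // ?(lt_trans qq') // -El IHP // => i iP.
exact: (H i.+1).
Qed.

(** * Permutations as words *)

Lemma mem_int_range (n : nat) (x : int) :
  (x \in int_range n) = (1 <= x <= n%:Z)%R.
Proof.
apply/imfsetP/idP => [[i /= + ->]|xn]; first by rewrite mem_iota; lia.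
by exists `|x|; rewrite /= ?mem_iota; lia.
Qed.

Lemma mem_pm_range (n : nat) (x : int) :
  (x \in pm_range n) = (1 <= `|x| <= n).
Proof.
rewrite in_fsetU mem_int_range.
have -> : (x \in [fset (- y)%R | y in int_range n]%fset)
    = (- x \in int_range n)%R.
  apply/imfsetP/idP => [[y /= yn ->]|xn]; first by rewrite opprK.
  by exists (- x)%R; rewrite ?opprK.
by rewrite mem_int_range; lia.
Qed.

Lemma int_range_sub_pm (n : nat) : (int_range n `<=` pm_range n)%fset.
Proof. exact: fsubsetUl. Qed.

Definition word (n : nat) (A : {fset int}) (w : {perm A}) : seq int :=
  [seq app w (Posz i) | i <- iota 1 n].

Lemma size_word (n : nat) (A : {fset int}) (w : {perm A}) :
  size (word n w) = n.
Proof. by rewrite size_map size_iota. Qed.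

Lemma nth_word (n : nat) (A : {fset int}) (w : {perm A}) (i : nat) :
  i < n -> nth 0%R (word n w) i = app w (Posz i.+1).
Proof.
by move=> ni; rewrite (nth_map 0) ?size_iota // nth_iota // add1n.
Qed.

Lemma mem_pinnacle_set (n : nat) (A : {fset int}) (w : {perm A}) :
  (int_range n `<=` A)%fset -> pinnacle_set n w =i pins (word n w).
Proof.
move=> /fsubsetP nA x; apply/imfsetP/mem_pinsP.
- move=> [i /= /andP[_ /and4P[i2 ni h1 h2]] ->].
  (* [mem_pinsP] records the index of the left neighbour, counted from 0, hence the shift by two
     from the position [i]. *)
  exists `|i|.-2; first by rewrite size_word; lia.
  rewrite !nth_word; try lia.
  have -> : Posz `|i|.-2.+1 = (i - 1)%R by lia.
  have -> : Posz `|i|.-2.+2 = i by lia.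
  by have -> : Posz `|i|.-2.+3 = (i + 1)%R by lia.
- move=> [i]; rewrite size_word => ni; rewrite !nth_word; try lia.
  move=> [-> h1 h2]; exists (Posz i.+2) => //.
  apply/andP; split; first by apply: nA; rewrite mem_int_range; lia.
  apply/and4P; split; try lia.
    by have -> : (Posz i.+2 - 1)%R = Posz i.+1 by lia.
  by have -> : (Posz i.+2 + 1)%R = Posz i.+3 by lia.
Qed.

Lemma app_in (A : {fset int}) (w : {perm A}) (x : int) :
  x \in A -> app w x \in A.
Proof. by move=> xA; rewrite /app insubT; apply: fsvalP. Qed.

Lemma app_inj (A : {fset int}) (w : {perm A}) : {in A &, injective (app w)}.
Proof.
move=> x y xA yA; rewrite /app !insubT => /val_inj/perm_inj.
by move/(congr1 val).
Qed.

Lemma perm_of_fun (A : {fset int}) (f : int -> int) :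
  {in A, forall x, f x \in A} -> {in A &, injective f} ->
  exists w : {perm A}, {in A, app w =1 f}.
Proof.
move=> fA finj; pose g (x : A) : A := insubd x (f (val x)).
have vg x : val (g x) = f (val x).
  by rewrite val_insubd; have /fA -> := valP x.
have ginj : injective g.
  move=> x y /(congr1 val); rewrite !vg => /finj E.
  by apply/val_inj/E; apply: valP.
by exists (perm ginj) => x xA; rewrite /app insubT permE vg.
Qed.

Definition ints (n : nat) : seq int := [seq Posz i | i <- iota 1 n].

Lemma mem_ints (n : nat) (x : int) : (x \in ints n) = (x \in int_range n).
Proof.
rewrite mem_int_range; apply/mapP/idP => [[i + ->]|xn].
  by rewrite mem_iota; lia.
by exists `|x|; rewrite ?mem_iota; lia.
Qed.

Lemma ints_uniq (n : nat) : uniq (ints n).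
Proof. by rewrite map_inj_uniq ?iota_uniq // => i j []. Qed.

Lemma sorted_ints (n : nat) : sorted <%R (ints n).
Proof.
rewrite sorted_map; apply: sub_sorted (iota_ltn_sorted 1 n) => i j /=; lia.
Qed.

Lemma perm_word_ints (n : nat) (w : {perm int_range n}) :
  perm_eq (word n w) (ints n).
Proof.
have wu : uniq (word n w).
  rewrite map_inj_in_uniq ?iota_uniq // => i j; rewrite !mem_iota => ni nj E.
  by have := @app_inj _ w _ _ _ _ E; rewrite !mem_int_range; lia.
have sub : {subset word n w <= ints n}.
  move=> _ /mapP[i + ->]; rewrite mem_iota mem_ints => ni.
  by apply: app_in; rewrite mem_int_range; lia.
apply: uniq_perm => //; first exact: ints_uniq.
by apply: (uniq_min_size wu sub _).2; rewrite size_word size_map size_iota.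
Qed.

(* The odd extension of s, seen as a function of the positions 1, ..., n. *)
Definition signed_fun (s : seq int) (x : int) : int :=
  (sgz x * nth 0 s `|x|.-1)%R.

(** * Signed permutations from their one-line notation *)

Section SignedWord.
Variables (n : nat) (s : seq int).
Hypothesis sn : perm_eq (map absz s) (iota 1 n).

Lemma size_signed_word : size s = n.
Proof. by have := perm_size sn; rewrite size_map size_iota. Qed.

Lemma absz_signed_fun (x : int) : x \in pm_range n ->
  `|signed_fun s x| = nth 0 (map absz s) `|x|.-1.
Proof.
rewrite mem_pm_range => xn; rewrite (nth_map 0%R) ?size_signed_word; last lia.
rewrite /signed_fun abszM; have -> : `|sgz x| = 1 by lia.
by rewrite mul1n.
Qed.

Lemma signed_fun_in : {in pm_range n, forall x, signed_fun s x \in pm_range n}.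
Proof.
move=> x xn; rewrite mem_pm_range absz_signed_fun //.
have : nth 0 (map absz s) `|x|.-1 \in iota 1 n.
  rewrite -(perm_mem sn) mem_nth // size_map size_signed_word.
  by move: xn; rewrite mem_pm_range; lia.
by rewrite mem_iota; lia.
Qed.

(** The absolute values in [s] are distinct, so the image determines [|x|]; the image is nonzero, so
    its sign then determines the sign of [x]. *)
Lemma signed_fun_inj : {in pm_range n &, injective (signed_fun s)}.
Proof.
move=> x y xn yn E.
have : `|x|.-1 = `|y|.-1.
  have /(uniqP 0) : uniq (map absz s) by rewrite (perm_uniq sn) iota_uniq.
  apply; rewrite ?inE ?size_map ?size_signed_word.
  - by move: xn; rewrite mem_pm_range; lia.
  - by move: yn; rewrite mem_pm_range; lia.
  - by rewrite -!absz_signed_fun // E.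
move=> Exy; have := signed_fun_in xn.
move: E; rewrite /signed_fun Exy; move: xn yn; rewrite !mem_pm_range.
move: (nth _ _ _) Exy => z Exy xn yn.
by case: (ltgtP 0%R x) (ltgtP 0%R y) => hx [] hy; nia.
Qed.

Lemma signed_perm_of_word :
  exists2 w : {perm pm_range n}, is_signed_perm w & word n w = s.
Proof.
have [w wE] := perm_of_fun signed_fun_in signed_fun_inj; exists w.
  apply/forallP => -[x xn] /=; apply/eqP; rewrite !wE //; last first.
    by move: xn; rewrite !mem_pm_range abszN.
  by rewrite /signed_fun sgzN abszN mulNr.
apply: (@eq_from_nth _ 0%R); first by rewrite size_word size_signed_word.
move=> i; rewrite size_word => ni; rewrite nth_word // wE.
  by rewrite /signed_fun mul1r.
by rewrite mem_pm_range; lia.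
Qed.

End SignedWord.

Lemma perm_of_word (n : nat) (s : seq int) : perm_eq s (ints n) ->
  exists w : {perm int_range n}, word n w = s.
Proof.
move=> sn; have ss : size s = n by rewrite (perm_size sn) size_map size_iota.
have [x xn|x y xn yn|w wE] :=
  @perm_of_fun (int_range n) (fun x => nth 0%R s `|x|.-1).
- rewrite -mem_ints -(perm_mem sn) mem_nth // ss.
  by move: xn; rewrite mem_int_range; lia.
- have /(uniqP 0%R) U : uniq s by rewrite (perm_uniq sn) ints_uniq.
  move/U; rewrite !inE ss; move: xn yn; rewrite !mem_int_range; lia.
exists w; apply: (@eq_from_nth _ 0%R); first by rewrite size_word ss.
move=> i; rewrite size_word => ni; rewrite nth_word // wE //.
by rewrite mem_int_range; lia.
Qed.

(** * Admissible pinnacle sets *)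

Lemma size_ints (n : nat) : size (ints n) = n.
Proof. by rewrite size_map size_iota. Qed.

Lemma nth_ints (n i : nat) (x0 : int) : i < n -> nth x0 (ints n) i = Posz i.+1.
Proof. by move=> ni; rewrite (nth_map 0) ?size_iota // nth_iota. Qed.

Lemma filter_le_ints (m n : nat) : m <= n ->
  [seq x <- ints n | (x <= m%:Z)%R] = ints m.
Proof.
move=> mn; rewrite /ints -(subnKC mn) iotaD map_cat filter_cat.
rewrite (all_filterP _) ?(eq_in_filter (a2 := pred0)) ?filter_pred0 ?cats0 //.
  by move=> _ /mapP[i + ->]; rewrite mem_iota /=; lia.
by apply/allP => _ /mapP[i + ->]; rewrite mem_iota; lia.
Qed.

Lemma count_le_filter_ints (a : pred int) (m n : nat) : m <= n ->
  count (fun x => x <= m%:Z)%R (filter a (ints n)) = count a (ints m).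
Proof.
move=> mn; rewrite -(filter_le_ints mn) !count_filter.
by apply: eq_count => x /=; rewrite andbC.
Qed.

Definition bits (n : nat) (S : {fset int}) : seq bool :=
  [seq x \in S | x <- ints n].

Lemma count_take_bits (m n : nat) (S : {fset int}) :
  count id (take m (bits n S)) = count (mem S) (ints (minn m n)).
Proof. by rewrite /bits /ints -!map_take take_iota count_map. Qed.

Lemma count_bits (n : nat) (S : {fset int}) :
  count id (bits n S) = count (mem S) (ints n).
Proof. exact: count_map. Qed.

(** The elements of [S] in [m] are distinct entries of [pins l] that are at most [m], so
    [count_pins] bounds their number. *)
Lemma count_pinnacles (S : {fset int}) (l : seq int) (m : nat) :
  pins l =i S ->
  2 * count (mem S) (ints m) <= (count (fun x => x <= m%:Z)%R l).-1.
Proof.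
move=> lS; apply: leq_trans (count_pins m%:Z l); rewrite leq_mul2l /=.
rewrite -!size_filter; apply: uniq_leq_size => [|x].
  by rewrite filter_uniq ?ints_uniq.
rewrite !mem_filter lS mem_ints mem_int_range => /andP[xS xm].
by apply/andP; split; [lia|exact: xS].
Qed.

(** The word of an unsigned permutation has exactly [minn m n] entries up to [minn m n], which turns
    [count_pinnacles] into the ballot bound. *)
Lemma APS_admissible (n : nat) (S : {fset int}) : S \in APS n ->
  (S `<=` int_range n)%fset && admissible (bits n S).
Proof.
case/imfsetP => /= w _ ->; have pE := mem_pinnacle_set w (fsubset_refl _).
apply/andP; split.
  apply/fsubsetP => x; rewrite pE => /(mem_subseq (subseq_pins _)).
  by rewrite (perm_mem (perm_word_ints w)) mem_ints.
apply/admissibleP => m; rewrite count_take_bits.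
apply: leq_trans (count_pinnacles _ (fsym pE)) _.
rewrite (seq.permP (perm_word_ints w)) -(filter_predT (ints n)).
rewrite count_le_filter_ints ?geq_minr // count_predT size_ints; lia.
Qed.

(** * Permutations with a prescribed pinnacle set *)

Section Construction.
Variables (n : nat) (S : {fset int}).
Hypothesis Sn : (S `<=` int_range n)%fset.

Let P : seq int := filter (mem S) (ints n).
Let Q : seq int := filter (predC (mem S)) (ints n).

Let mem_P : P =i S.
Proof.
move=> x; rewrite mem_filter mem_ints /=.
by case: (boolP (x \in S)) => // /(fsubsetP Sn).
Qed.

Let perm_PQ : perm_eq (P ++ Q) (ints n).
Proof. by rewrite perm_filterC. Qed.

Let size_PQ : size P + size Q = n.
Proof. by rewrite -size_cat (perm_size perm_PQ) size_ints. Qed.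

Let size_P : size P = count id (bits n S).
Proof. by rewrite size_filter count_bits. Qed.

Let sorted_P : sorted <%R P.
Proof. by apply: sorted_filter (sorted_ints n); apply: lt_trans. Qed.

Let sorted_Q : sorted <%R Q.
Proof. by apply: sorted_filter (sorted_ints n); apply: lt_trans. Qed.

(** The ballot bound at [m = n] makes [P] shorter than [Q]; at each element of [P] it yields the
    comparison that [pins_weave] requires. *)
Lemma admissible_APS : 0 < n -> admissible (bits n S) -> S \in APS n.
Proof.
move=> n0 /admissibleP adm.
have PQ : size P < size Q.
  have := adm n; rewrite take_oversize -?size_P ?size_map ?size_iota //; lia.
have nthPQ i : i < size P -> (nth 0 Q i.+1 < nth 0 P i)%R.
  move=> iP; set x := nth 0%R P i.
  have xP : x \in P by rewrite mem_nth.
  have xn : (1 <= x <= n%:Z)%R.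
    by rewrite -mem_int_range; apply: (fsubsetP Sn); rewrite -mem_P.
  have Ex : x = Posz `|x|%N by lia.
  have cP : count (fun y => y <= Posz `|x|%N)%R P = i.+1.
    by rewrite -Ex; apply: count_le_nth.
  have cPQ : count (fun y => y <= Posz `|x|%N)%R (P ++ Q) = `|x|.
    rewrite (seq.permP perm_PQ) -(filter_predT (ints n)).
    by rewrite count_le_filter_ints ?count_predT ?size_ints //; lia.
  (* With [i.+1] elements of [S] up to [x], the bound at [m = x] says that [2 * i.+1 <= x - 1],
     which leaves at least [i.+2] entries of [Q] up to [x]. *)
  have := adm `|x|; rewrite count_take_bits (minn_idPl _); last by lia.
  rewrite -(@count_le_filter_ints _ _ n); last by lia.
  move: cPQ; rewrite count_cat cP => cQ bnd.
  have QxP : (nth 0 Q i.+1 <= x)%R.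
    apply: nth_count_le; first by apply: sub_sorted sorted_Q => ? ? /ltW.
    have cQ' : i.+1 < count (fun y => y <= Posz `|x|%N)%R Q by lia.
    by rewrite Ex; exact: cQ'.
  (* Equality would put an entry of [Q] into [P]. *)
  rewrite lt_neqAle QxP andbT; apply: contraL xP => /eqP <-.
  have : nth 0%R Q i.+1 \in Q by apply: mem_nth; apply: leq_trans PQ.
  by rewrite mem_P mem_filter => /andP[].
have [|w wE] := @perm_of_word n (weave P Q).
  by apply: perm_trans perm_PQ; apply: perm_weave; lia.
apply/imfsetP; exists w => //; apply/fsetP => x.
by rewrite mem_pinnacle_set // wE pins_weave // mem_P.
Qed.

Lemma light_APSplus : 2 * count id (bits n S) < n -> S \in APSplus n.
Proof.
rewrite -size_P => light.
(* Negation reverses the order; [rev] makes the list increasing again, as [pins_weave] needs. All of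
   [Q'] lies below the positive [P], so only the sizes matter. *)
pose Q' : seq int := rev [seq (- x)%R | x <- Q].
have sQ' : size Q' = size Q by rewrite size_rev size_map.
have sortedQ' : sorted <%R Q'.
  rewrite rev_sorted sorted_map; apply: sub_sorted sorted_Q => x y /=.
  by rewrite ltrN2.
have nthPQ i : i < size P -> (nth 0 Q' i.+1 < nth 0 P i)%R.
  move=> iP.
  have : nth 0%R P i \in P by apply: mem_nth.
  rewrite mem_P => /(fsubsetP Sn); rewrite mem_int_range.
  have : nth 0%R Q' i.+1 \in Q' by apply: mem_nth; rewrite sQ'; lia.
  rewrite mem_rev => /mapP[y + ->].
  by rewrite mem_filter mem_ints mem_int_range; lia.
have [|w ws wE] := @signed_perm_of_word n (weave P Q').
  have -> : iota 1 n = map absz (ints n).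
    by rewrite /ints -map_comp map_id_in.
  apply: perm_trans (perm_map absz perm_PQ).
  apply: perm_trans (perm_map absz (perm_weave _)) _; first by lia.
  rewrite !map_cat perm_cat2l /Q' map_rev perm_rev -map_comp.
  by rewrite (eq_map (g := absz)) // => x /=; rewrite abszN.
have pE : pinnacle_set n w = S.
  apply/fsetP => x; rewrite mem_pinnacle_set ?int_range_sub_pm // wE.
  by rewrite pins_weave ?mem_P //; lia.
rewrite inE /=; apply/andP; split.
  by apply/imfsetP; exists w; rewrite //= inE ws.
apply/forallP => x; have /(fsubsetP Sn) := valP x.
by rewrite mem_int_range => /andP[x1 _]; apply: lt_le_trans x1.
Qed.

End Construction.

(** * Membership criteria *)

Lemma APSplus_light (n : nat) (S : {fset int}) : S \in APSplus n ->
  (S `<=` int_range n)%fset && (2 * count id (bits n S) <= n.-1).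
Proof.
rewrite inE /= => /andP[/imfsetP[w /= ws ->] /forallP Spos].
have pE := mem_pinnacle_set w (int_range_sub_pm n).
apply/andP; split.
  apply/fsubsetP => x xS; have /= pos := Spos [` xS]%fset.
  move: xS pos; rewrite pE => /(mem_subseq (subseq_pins _)) /mapP[i + ->] /=.
  rewrite mem_iota => ni pos.
  have : app w i \in pm_range n by apply: app_in; rewrite mem_pm_range; lia.
  by rewrite mem_pm_range mem_int_range; lia.
(* Negative entries also count as at most [m], so the bound is used only at [m = n], where the whole
   word of length [n] bounds the count. *)
rewrite count_bits; apply: leq_trans (count_pinnacles _ (fsym pE)) _.
rewrite -!subn1 leq_sub2r // -[X in _ <= X](size_word n w).
exact: count_size.
Qed.

Lemma mem_APS (n : nat) (S : {fset int}) : 0 < n ->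
  (S \in APS n) = (S `<=` int_range n)%fset && admissible (bits n S).
Proof.
move=> n0; apply/idP/idP => [/APS_admissible//|/andP[Sn]].
exact: admissible_APS.
Qed.

Lemma mem_APSplus (k : nat) (S : {fset int}) :
  (S \in APSplus (2 * k + 1)) =
  (S `<=` int_range (2 * k + 1))%fset
    && (count id (bits (2 * k + 1) S) <= k).
Proof.
apply/idP/idP => [/APSplus_light/andP[-> ] /=|/andP[Sn Sk]]; first by lia.
by apply: light_APSplus => //; lia.
Qed.

(** * Subsets of [n] as bit sequences, and the final count *)

Lemma bits_inj (n : nat) (S T : {fset int}) :
  (S `<=` int_range n)%fset -> (T `<=` int_range n)%fset ->
  bits n S = bits n T -> S = T.
Proof.
move=> /fsubsetP Sn /fsubsetP Tn /eq_in_map E; apply/fsetP => x.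
have [xn|xn] := boolP (x \in ints n); first exact: E.
rewrite mem_ints in xn.
by rewrite (contraNF (Sn x) xn) (contraNF (Tn x) xn).
Qed.

Lemma bits_surj (n : nat) (b : seq bool) : size b = n ->
  exists2 S, (S `<=` int_range n)%fset & bits n S = b.
Proof.
move=> sb; exists [fset x in ints n | nth false b `|x|.-1]%fset.
  by apply/fsubsetP => x; rewrite !inE -mem_ints => /andP[].
apply: (@eq_from_nth _ false); first by rewrite size_map size_ints.
rewrite size_map size_ints => i ni.
rewrite (nth_map 0%R) ?size_ints // nth_ints // !inE mem_ints mem_int_range /=.
by rewrite andb_idl //; lia.
Qed.

Local Open Scope fset_scope.
Local Open Scope ring_scope.

Theorem theorem4p11 (k : nat) :
  (#|` APSplus (2 * k + 1) `\` APS (2 * k + 1)|)%:Z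
    = 4 ^+ k - 'C(2 * k, k)%:Z.
Proof.
set n := (2 * k + 1)%N; set X := _ `\` _.
pose light b := (count id b <= k)%N && ~~ admissible b.
have memX S : (S \in X) = (S `<=` int_range n) && light (bits n S).
  rewrite in_fsetD mem_APSplus mem_APS -/n /light; last by rewrite /n; lia.
  by case: (_ `<=` _) (admissible _) (_ <= k)%N => -[] [].
(* Through [bits n], the set [X] becomes a duplicate-free list with the same members as the light
   inadmissible part of [bitseqs n]. *)
have -> : #|` X| = count light (bitseqs n).
  rewrite -(size_map (bits n)) -size_filter; apply/perm_size/uniq_perm.
  - rewrite map_inj_in_uniq ?fset_uniq // => S T.
    by rewrite !memX => /andP[Sn _] /andP[Tn _]; apply: bits_inj.
  - by rewrite filter_uniq ?bitseqs_uniq.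
  move=> b; rewrite mem_filter mem_bitseqs; apply/mapP/andP.
    move=> [S]; rewrite memX => /andP[Sn lS] ->.
    by rewrite lS size_map size_ints.
  move=> [lb /eqP/bits_surj[S Sn Sb]]; exists S => //.
  by rewrite memX Sn Sb.
have := count_light_inadmissible k; rewrite -/n -/light => E.
have <- : (4 ^ k)%N%:Z = 4 ^+ k by rewrite -[LHS]natz natrX.
by rewrite -E PoszD addrK.
Qed.
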